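(* For all integers $k>1$ and $m\ge 1$, the DFA $\mathcal{L}_m^k$ is an $A_k$-automaton.
   Context: A DFA $\mathcal{A}=(Q,\Sigma)$ consists of finite nonempty sets $Q$ (states) and $\Sigma$ (letters) with a map $Q\times\Sigma\to Q$, $(q,a)\mapsto q\cdot a$, extended to words by $q\cdot\varepsilon=q$, $q\cdot(wa)=(q\cdot w)\cdot a$, and to subsets by $P\cdot w=\{p\cdot w:p\in P\}$. A word $w$ is a reset word for $\mathcal{A}$ if $|Q\cdot w|=1$. For a positive integer $k$, the $k$-game on $\mathcal{A}$: two players, Alice and Bob, alternate moves. On each of her turns Alice chooses a letter of $\Sigma$; on each of his turns Bob chooses a word over $\Sigma$ of length less than $k$ (possibly empty). The history of the game up to a turn is the concatenation, in order, of all letters and words chosen so far. Alice wins if at some turn the history is a reset word for $\mathcal{A}$; Bob wins if the game continues forever. (It does not matter who moves first.) $\mathcal{A}$ is an $A_k$-automaton if Alice has a winning strategy in the $k$-game on $\mathcal{A}$. The DFA $\mathcal{L}_m^k$: put $n=k+m+1$. The state set is $\{0,1,\dots,n-1\}$ and the input alphabet is $\{a_1,\dots,a_{k+m}\}$. For $i=1,\dots,k$: $i\cdot a_i=0$ and $q\cdot a_i=q$ for $q\neq i$. For $j=1,\dots,m$: $q\cdot a_{k+j}=q+1$ if $j\le q<k+j$; $(k+j)\cdot a_{k+j}=j$; and $q\cdot a_{k+j}=q$ for all other $q$. *)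

(* Defs.v *)
From mathcomp Require Import all_boot.
From mathcomp Require Import zify.

Set Implicit Arguments.
Unset Strict Implicit.
Unset Printing Implicit Defensive.

Record dfa := Dfa {
  state : finType;
  letter : finType;
  trans : state -> letter -> state;
  state_gt0 : 0 < #|state|;
  letter_gt0 : 0 < #|letter|
}.

Definition trans_word (A : dfa) (q : state A) (w : seq (letter A)) : state A :=
  foldl (@trans A) q w.

Definition trans_set (A : dfa) (P : {set state A}) (w : seq (letter A)) :
    {set state A} :=
  [set trans_word p w | p in P].

Definition reset_word (A : dfa) (w : seq (letter A)) : bool :=
  #|trans_set [set: state A] w| == 1.

Inductive player := Alice | Bob.

Definition opponent (x : player) : player :=
  match x with Alice => Bob | Bob => Alice end.

Definition mover (first : player) (t : nat) : player :=
  iter t opponent first.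

(* A play is an infinite sequence of words, the letters chosen by Alice being
   recorded as one-letter words.  Going on after Alice has won is harmless,
   since every word extending a reset word is a reset word. *)
Definition play (A : dfa) := nat -> seq (letter A).

(* The moves made before turn t, in order. *)
Definition moves (A : dfa) (p : play A) (t : nat) : seq (seq (letter A)) :=
  mkseq p t.

Definition history (A : dfa) (p : play A) (t : nat) : seq (letter A) :=
  flatten (moves p t).

(* A strategy for Alice sees all the moves made so far. *)
Definition strategy (A : dfa) := seq (seq (letter A)) -> letter A.

Definition follows (A : dfa) (k : nat) (first : player) (s : strategy A)
    (p : play A) : Prop :=
  forall t : nat,
    match mover first t with
    | Alice => p t = [:: s (moves p t)]
    | Bob => size (p t) < k
    end.

Definition winning_strategy (A : dfa) (k : nat) (first : player)
    (s : strategy A) : Prop :=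
  forall p : play A, follows k first s p -> exists t, reset_word (history p t).

(* Who moves first does not affect the outcome: a word having a reset factor
   is a reset word, so an extra opening move neither hurts nor helps.  Both
   variants of the game are required to be won. *)
Definition Ak_automaton (k : nat) (A : dfa) : Prop :=
  forall first : player, exists s : strategy A, winning_strategy k first s.

(* The action of a_i, for 1 <= i <= k + m, on the state q of L_m^k; when i > k
   the letter a_i is a_(k+j) with j = i - k. *)
Definition L_step (k i q : nat) : nat :=
  if i <= k then (if q == i then 0 else q)
  else let j := i - k in
    if j <= q < k + j then q.+1
    else if q == k + j then j
    else q.

Lemma L_step_lt (k m i q : nat) :
  i <= k + m -> q < (k + m).+1 -> L_step k i q < (k + m).+1.
Proof.
rewrite /L_step => le_i lt_q; case: (leqP i k) => le_ik; first by case: ifP.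
by case: ifP => [|_]; [lia | case: ifP => _; lia].
Qed.

(* The ordinal x : 'I_(k + m) stands for the letter a_(x+1). *)
Definition L_trans (k m : nat) (q : 'I_(k + m).+1) (x : 'I_(k + m)) :
    'I_(k + m).+1 :=
  Ordinal (L_step_lt (ltn_ord x) (ltn_ord q)).

Lemma L_state_gt0 (k m : nat) : 0 < #|'I_(k + m).+1|.
Proof. by rewrite card_ord. Qed.

Lemma L_letter_gt0 (k m : nat) : 0 < k -> 0 < #|'I_(k + m)|.
Proof. by rewrite card_ord addn_gt0 => ->. Qed.

(* The positivity of k only serves to make the alphabet nonempty. *)
Definition L_dfa (k m : nat) (k_gt0 : 0 < k) : dfa :=
  Dfa (@L_trans k m) (L_state_gt0 k m) (L_letter_gt0 m k_gt0).

Arguments L_dfa k m k_gt0 : clear implicits.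

(* Main.v *)
(* State 0 is a sink, so Alice wins once every state has been sent to 0.  She
   fixes a state not yet sent to 0 and, when it currently sits at p, plays a_p.
   If p <= k it is sent to 0; otherwise it drops to p - k, and since a letter
   raises a position by at most 1, Bob's reply brings it to at most p - 1.  So
   the position of the chosen state decreases strictly until it reaches 0. *)
Require Import Defs.
From mathcomp Require Import all_boot.
From mathcomp Require Import zify.

Set Implicit Arguments.
Unset Strict Implicit.
Unset Printing Implicit Defensive.

Lemma trans_word_cat (A : dfa) (q : state A) (u v : seq (letter A)) :
  trans_word q (u ++ v) = trans_word (trans_word q u) v.
Proof. exact: foldl_cat. Qed.

Lemma trans_word_cons (A : dfa) (q : state A) (x : letter A) (w : seq (letter A)) :
  trans_word q (x :: w) = trans_word (trans q x) w.
Proof. by []. Qed.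

Lemma historyS (A : dfa) (p : play A) (t : nat) :
  history p t.+1 = history p t ++ p t.
Proof.
by rewrite /history /moves /mkseq -addn1 iotaD map_cat flatten_cat /= cats0.
Qed.

Lemma opponentK : involutive opponent.
Proof. by case. Qed.

Section LAutomaton.

Variables (k m : nat) (k_gt0 : 0 < k).
Local Notation A := (L_dfa k m k_gt0).

Definition pos (q : state A) : nat := (q : 'I_(k + m).+1).

Lemma L_step0 i : 0 < i -> L_step k i 0 = 0.
Proof. by rewrite /L_step; case: leqP => // lt_ki; repeat case: ifP; lia. Qed.

Lemma L_step_leS i q : L_step k i q <= q.+1.
Proof. by rewrite /L_step; repeat case: ifP; lia. Qed.

(** Truncated subtraction covers both kinds of letters: for [q <= k] the letter sends [q] to 0, and
    for [q > k] it closes the cycle that runs from [q - k] up to [q]. *)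
Lemma L_step_self q : L_step k q q = q - k.
Proof. by rewrite /L_step; repeat case: ifP; lia. Qed.

Lemma trans_word0 (w : seq (letter A)) : trans_word (ord0 : state A) w = ord0.
Proof.
elim: w => //= x w IHw.
by rewrite /trans_word /= (_ : L_trans _ _ = ord0) //; apply/val_inj/L_step0.
Qed.

Lemma trans_word_le (q : state A) (w : seq (letter A)) :
  pos (trans_word q w) <= pos q + size w.
Proof.
elim: w q => [|x w IHw] q; first by rewrite addn0.
by apply: leq_trans (IHw _) _; rewrite addnS -addSn leq_add2r; apply: L_step_leS.
Qed.

Definition live (h : seq (letter A)) : {set state A} :=
  [set q | trans_word q h != ord0].

Lemma live_cat h w : live (h ++ w) \subset live h.
Proof.
apply/subsetP => q; rewrite !inE trans_word_cat.
by apply: contra_neq => ->; rewrite trans_word0.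
Qed.

Lemma live0_reset h : live h = set0 -> reset_word h.
Proof.
move=> live0; have dead q : trans_word q h = ord0.
  by apply/eqP/negbNE; have /setP/(_ q) := live0; rewrite !inE => ->.
apply/cards1P; exists ord0; apply/setP => q; rewrite inE.
by apply/imsetP/eqP => [[r _ ->] | ->] //; exists ord0.
Qed.

(* The choice depends on [h] only through [live h], so it does not change as
   long as no state dies. *)
Definition target (h : seq (letter A)) : state A := odflt ord0 [pick q in live h].

Definition target_pos h : nat := pos (trans_word (target h) h).

(** The predecessor accounts for ordinals starting at 0 while letters are numbered from 1. The
    fallback letter is never reached from the position of a state. *)
Definition letter_at (p : nat) : letter A :=
  insubd (Ordinal (leq_trans k_gt0 (leq_addr m k))) p.-1.

Lemma target_live h : live h != set0 -> target h \in live h.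
Proof.
by rewrite /target; case: pickP => [// | no] /set0Pn[q]; rewrite no.
Qed.

Lemma trans_letter_at (q : state A) :
  0 < pos q -> pos (trans q (letter_at (pos q))) = pos q - k.
Proof.
move=> q_gt0; have lt_q : (pos q).-1 < k + m by rewrite -ltnS prednK ?ltn_ord.
by rewrite {1}/pos /= val_insubd lt_q prednK //; apply: L_step_self.
Qed.

(** A lexicographic order packed into one number: the weight exceeds every position, so the death of
    a state outweighs any jump in position caused by a change of target. *)
Definition measure h := #|live h| * (k + m).+1 + target_pos h.

Lemma measure_round h w : live h != set0 -> size w < k ->
  measure (h ++ letter_at (target_pos h) :: w) < measure h.
Proof.
move=> live_n0 lt_wk; set v := _ :: w.
have [eq_live | ne_live] := eqVneq (live (h ++ v)) (live h); last first.
  have lt_live : #|live (h ++ v)| < #|live h|.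
    by apply: proper_card; rewrite properEneq ne_live live_cat.
  have := ltn_ord (trans_word (target (h ++ v)) (h ++ v) : 'I_(k + m).+1).
  by rewrite -[nat_of_ord _]/(target_pos _) /measure; nia.
have eq_target : target (h ++ v) = target h by rewrite /target eq_live.
rewrite /measure eq_live ltn_add2l.
have: target h \in live (h ++ v) by rewrite eq_live target_live.
rewrite inE /target_pos eq_target trans_word_cat /v; set q := trans_word _ h.
have q_gt0 : 0 < pos q.
  by have := target_live live_n0; rewrite inE -/q lt0n.
rewrite /target_pos -/q trans_word_cons.
have := trans_letter_at q_gt0; set r := trans q _ => r_eq.
(* If [pos q <= k], Alice's letter sends the target to the sink, contradicting that it is still live
   after [v]. *)
have [le_qk | lt_kq _] := leqP (pos q) k.
  have -> : r = ord0 by apply: ord_inj; rewrite -[LHS]/(pos r) r_eq; apply/eqP.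
  by rewrite trans_word0 eqxx.
by apply: leq_ltn_trans (trans_word_le _ _) _; rewrite r_eq; lia.
Qed.

Definition chase : strategy A := fun ms => letter_at (target_pos (flatten ms)).

Lemma chase_winning first : winning_strategy k first chase.
Proof.
move=> p p_follows.
(* Induction on the measure, one step being a full round of two turns that starts with Alice. *)
have win_from t : mover first t = Alice -> exists t', reset_word (history p t').
  have [M] := ubnP (measure (history p t)); elim: M t => // M IHM t lt_M alice_t.
  have [/live0_reset | live_n0] := eqVneq (live (history p t)) set0.
    by exists t.
  apply: (IHM t.+2); last by rewrite /mover /= opponentK.
  have := p_follows t; rewrite alice_t => p_t.
  have := p_follows t.+1; rewrite /mover iterS -/(mover _ _) alice_t /= => p_t1.
  rewrite !historyS p_t -catA cat1s.
  exact: leq_trans (measure_round live_n0 p_t1) _.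
(* If Bob opens, the rounds start at turn 1, after whatever word he has played. *)
by case E: first; [apply: (win_from 0) | apply: (win_from 1)]; rewrite E.
Qed.

End LAutomaton.

Theorem proposition3p11 (k m : nat) (k_gt1 : 1 < k) (m_ge1 : 1 <= m) :
  Ak_automaton k (L_dfa k m (ltnW k_gt1)).
Proof.
by move=> first; exists (@chase k m (ltnW k_gt1)); apply: chase_winning.
Qed.
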